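(* Let $X$ and $Y$ be two separable, nowhere locally compact metrizable spaces such that $\varrho(X)$ is homeomorphic to $\varrho(Y)$. Then (i) $X$ is a Choquet space if and only if $Y$ is a Choquet space, and (ii) $X$ is meager if and only if $Y$ is meager.
   Context: For a Tychonoff space $X$, $\beta X$ is its Čech–Stone compactification and $X^\ast=\beta X\setminus X$. A point $p\in X^\ast$ is a remote point of $X$ if $p\notin \mathrm{cl}_{\beta X}(A)$ for every nowhere dense subset $A$ of $X$. $\varrho(X)$ denotes the set of remote points of $X$, with the subspace topology from $\beta X$. A space is nowhere locally compact if none of its points has a compact neighborhood. A space is meager if it is a countable union of nowhere dense subsets of itself. The Choquet game on a space $X$ is played by players $I$ and $II$ in $\omega$ steps: in step $n<\omega$, first $I$ chooses a non-empty open subset $U_n$ of $X$ with $U_n\subset V_{n-1}$ if $n\neq 0$, and then $II$ chooses a non-empty open subset $V_n$ of $U_n$. Player $II$ wins if $\bigcap_{n<\omega}V_n\neq\emptyset$; otherwise player $I$ wins. $X$ is a Choquet space if player $II$ has a winning strategy in the Choquet game on $X$. *)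

(* Defs.v *)
From HB Require Import structures.
From mathcomp Require Import all_boot all_order all_algebra.
From mathcomp Require Import all_classical reals topology.

Set Implicit Arguments.
Unset Strict Implicit.
Unset Printing Implicit Defensive.

Import Order.TTheory GRing.Theory Num.Theory.
Import numFieldTopology.Exports.

Local Open Scope classical_set_scope.
Local Open Scope ring_scope.

Definition homeomorphic (S T : topologicalType) : Prop :=
  exists (f : S -> T) (g : T -> S),
    [/\ continuous f, continuous g, cancel f g & cancel g f].

Definition separable_space (T : topologicalType) : Prop :=
  exists D : set T, countable D /\ dense D.

Definition metrizable (R : realType) (T : topologicalType) : Prop :=
  exists d : T -> T -> R,
    [/\ forall x y, 0 <= d x y,
        forall x y, d x y = 0 <-> x = y,
        forall x y, d x y = d y x,
        forall x y z, d x z <= d x y + d y z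
      & forall x (A : set T),
          nbhs x A <-> exists2 e, 0 < e & [set y | d x y < e] `<=` A].

Definition nowhere_locally_compact (T : topologicalType) : Prop :=
  forall x : T, ~ exists2 K : set T, nbhs x K & compact K.

Definition nowhere_dense (T : topologicalType) (A : set T) : Prop :=
  interior (closure A) = set0.

Definition meager_space (T : topologicalType) : Prop :=
  exists F : nat -> set T,
    (forall n, nowhere_dense (F n)) /\ \bigcup_n F n = [set: T].

(* The Cech-Stone compactification, as the closure of the image of T in the
   cube [0, 1]^C(T, [0, 1]) under evaluation. It is defined for every T, but
   the evaluation map is an embedding only when T is Tychonoff. *)
Definition unit_interval (R : realType) : topologicalType :=
  set_type `[0 : R, 1 : R]%classic.

Definition stone_cech_cube (R : realType) (T : topologicalType)
    : topologicalType :=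
  prod_topology
    (fun _ : continuousType T (unit_interval R) => unit_interval R).

Definition stone_cech_eval (R : realType) (T : topologicalType) (x : T)
    : stone_cech_cube R T :=
  fun f => f x.
Arguments stone_cech_eval R {T} x.

Definition stone_cech (R : realType) (T : topologicalType) : topologicalType :=
  set_type (closure (range (@stone_cech_eval R T))).

Lemma stone_cech_eval_closure (R : realType) (T : topologicalType) (x : T) :
  stone_cech_eval R x \in closure (range (@stone_cech_eval R T)).
Proof. by apply: mem_set; apply: subset_closure; exists x. Qed.

Definition to_stone_cech (R : realType) (T : topologicalType) (x : T)
    : stone_cech R T :=
  exist _ (stone_cech_eval R x) (stone_cech_eval_closure R x).
Arguments to_stone_cech R {T} x.

Definition remote_points (R : realType) (T : topologicalType)
    : set (stone_cech R T) :=
  [set p | ~ range (@to_stone_cech R T) p /\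
           forall A : set T, nowhere_dense A ->
             ~ closure (to_stone_cech R @` A) p].
Arguments remote_points R T : clear implicits.

(* A strategy of player II maps the nonempty list U_0, ..., U_n of the moves
   made so far by player I to the answer V_n. *)
Definition choquet_strategy (T : Type) : Type := seq (set T) -> set T.

Definition choquet_answer (T : Type) (s : choquet_strategy T)
    (U : nat -> set T) (n : nat) : set T :=
  s (mkseq U n.+1).

Definition choquet_move_I (T : topologicalType) (s : choquet_strategy T)
    (U : nat -> set T) (n : nat) : Prop :=
  [/\ open (U n), U n !=set0
    & forall m, n = m.+1 -> U n `<=` choquet_answer s U m].

Definition choquet_move_II (T : topologicalType) (s : choquet_strategy T)
    (U : nat -> set T) (n : nat) : Prop :=
  [/\ open (choquet_answer s U n), choquet_answer s U n !=set0
    & choquet_answer s U n `<=` U n].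

(* II must answer legally at every finite stage reached with legal moves of I,
   and must win every infinite run. *)
Definition choquet_winning (T : topologicalType) (s : choquet_strategy T)
    : Prop :=
  (forall U n, (forall k, (k <= n)%N -> choquet_move_I s U k) ->
     choquet_move_II s U n) /\
  (forall U, (forall n, choquet_move_I s U n) ->
     \bigcap_n choquet_answer s U n !=set0).

Definition choquet_space (T : topologicalType) : Prop :=
  exists s : choquet_strategy T, choquet_winning s.

(* Main.v *)
(* Write U -> V, for open U in X and V in Y, when the given homeomorphism
   h : rho(X) -> rho(Y) maps the remote points in the closure of U into the
   closure of V.

   Two facts drive the proof. By van Douwen's construction, a decreasing
   sequence of nonempty open sets whose closures have empty intersection has a remote
   point in the intersection of its closures in beta X; since X is nowhere
   locally compact, every nonempty open set contains such a sequence, so remote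
   points are dense. On the other hand, if the sequence shrinks to a point x of
   X, then the closures in beta X meet in x only, hence in no remote point.

   Density gives: if V -> U then some nonempty open U' inside U satisfies
   U' -> V. Hence sequences in X and Y can be interleaved,
   ... -> U_n -> V_n -> U_(n-1) -> ..., and when one of them shrinks to a point
   the other cannot have empty intersection, for a remote point in the latter
   would be carried by h to one in the former. Playing on Y the translation of a
   winning strategy for X transfers the Choquet property. For meagerness, the
   interleaved sequences form a tree whose levels avoid the given nowhere dense
   subsets of X and have dense union in Y; a point of Y in all of these dense
   open sets would yield a branch shrinking to it in Y and vanishing in X. *)
Require Import Defs.
From mathcomp Require Import all_boot all_order all_algebra.
From mathcomp Require Import all_classical reals topology.
From mathcomp Require Import interval_inference normedtype lra.

Set Implicit Arguments.
Unset Strict Implicit.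
Unset Printing Implicit Defensive.

Import Order.TTheory GRing.Theory Num.Theory.
Import numFieldTopology.Exports.

Local Open Scope classical_set_scope.

(** * Regular bases and vanishing sequences *)

(** Second countability and regularity in one condition. Members may be empty, hence the
    nonemptiness premises below. *)
Definition regular_base (X : topologicalType) (B : nat -> set X) : Prop :=
  (forall i, open (B i)) /\
  (forall x O, nbhs x O -> exists i, B i x /\ closure (B i) `<=` O).

(* If [decides B n (U n)] and [U n x] for all [n], then the [U n] form a local
   base at [x]: this replaces sets of diameter tending to 0. *)
Definition decides (X : topologicalType) (B : nat -> set X) (n : nat)
    (U : set X) : Prop :=
  forall i, (i <= n)%N -> U `<=` B i \/ U `&` B i = set0.

Definition vanishing (X : topologicalType) (W : nat -> set X) : Prop :=
  [/\ forall n, open (W n), forall n, W n !=set0,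
      forall n, W n.+1 `<=` W n & forall x, exists n, ~ closure (W n) x].

Section Base.
Variables (X : topologicalType) (B : nat -> set X).
Hypothesis baseB : regular_base B.

Lemma base_open i : open (B i). Proof. by case: baseB => + _; exact. Qed.

Lemma base_refine (U : set X) : open U -> U !=set0 ->
  exists i, B i !=set0 /\ closure (B i) `<=` U.
Proof.
move=> oU [x Ux]; have [_ /(_ x U)] := baseB.
case=> [|i [Bix BiU]]; first exact: open_nbhs_nbhs.
by exists i; split => //; exists x.
Qed.

(** Intersect with [B m] whenever the current set meets it; either alternative of [decides] survives
    further shrinking. *)
Lemma decides_exists (n : nat) (U : set X) : open U -> U !=set0 ->
  exists V, [/\ open V, V !=set0, V `<=` U & decides B n V].
Proof.
move=> oU U0.
suff [V [oV V0 VU H]] : exists V, [/\ open V, V !=set0, V `<=` U &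
    forall i, (i < n.+1)%N -> V `<=` B i \/ V `&` B i = set0].
  by exists V; split.
elim: n.+1 => [|m [V [oV V0 VU H]]]; first by exists U; split.
have [VB|] := eqVneq (V `&` B m) set0.
  exists V; split => // i; rewrite ltnS leq_eqVlt => /predU1P[->|].
    by right.
  exact: H.
move=> /set0P VB; exists (V `&` B m); split => //.
- by apply: openI => //; exact: base_open.
- exact: subset_trans (@subIsetl _ _ _) VU.
move=> i; rewrite ltnS leq_eqVlt => /predU1P[->|/H[VBi|VBi]].
- by left; exact: subIsetr.
- by left; exact: subset_trans (@subIsetl _ _ _) VBi.
- by right; rewrite setIAC VBi set0I.
Qed.

Lemma decides_nbhs (U : nat -> set X) (x : X) (O : set X) :
  (forall n, decides B n (U n)) -> (forall n, U n x) -> nbhs x O ->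
  exists n, U n `<=` O.
Proof.
move=> dU Ux xO; have [_ /(_ x O xO)[i [Bix BiO]]] := baseB.
exists i; have [UB|UB] := dU i i (leqnn i).
  by move=> y /UB /subset_closure /BiO.
by have : (U i `&` B i) x by []; rewrite UB.
Qed.

Lemma vanishing_exists (V : set X) : nowhere_locally_compact X ->
  open V -> V !=set0 -> exists2 W, vanishing W & closure (W 0) `<=` V.
Proof.
move=> nlc oV [x Vx]; have [_ /(_ x V)] := baseB.
case=> [|i [Bix BiV]]; first exact: open_nbhs_nbhs.
have : ~ compact (closure (B i)).
  move=> cBi; apply: (nlc x); exists (closure (B i)) => //.
  apply: filterS (@subset_closure _ _) _.
  by apply: open_nbhs_nbhs; split => //; exact: base_open.
move=> /existsNP[F] /not_implyP[PF] /not_implyP[FB] nclus.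
(* [C n] removes those [closure (B k)], [k < n], whose complement belongs to [F], a filter without
   cluster point in [closure (B i)]. *)
pose C n := [set y | forall k, (k < n)%N -> F (~` closure (B k)) ->
  ~ closure (B k) y].
have CS n : C n.+1 =
    C n `&` [set y | F (~` closure (B n)) -> ~ closure (B n) y].
  apply/seteqP; split => [y Cy|y [Cy Cny] k].
    split=> [k kn|]; last exact: Cy.
    by apply: Cy; rewrite ltnS ltnW.
  by rewrite ltnS leq_eqVlt => /predU1P[->//|]; exact: Cy.
have C0 : C 0 = setT by apply/seteqP; split.
have oFC n : open (C n) /\ F (C n).
  elim: n => [|n [oCn FCn]].
    by rewrite C0; split; [exact: openT|exact: filterT].
  rewrite CS; have [FBn|FBn] := pselect (F (~` closure (B n))).
    rewrite (_ : [set y | _] = ~` closure (B n)); last first.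
      by apply/seteqP; split => y //=; exact.
    split; last exact: filterI.
    by apply: openI => //; apply: closed_openC; exact: closed_closure.
  have -> : [set y | F (~` closure (B n)) -> ~ closure (B n) y] = setT.
    by apply/seteqP; split => // y _ /FBn.
  by rewrite setIT.
exists (fun n => B i `&` C n).
  split=> [n|n|n|y].
  - by apply: openI; [exact: base_open|exact: (oFC n).1].
  - have [y [By Cy]] := filter_ex (filterI FB (oFC n).2).
    by apply: By; apply: open_nbhs_nbhs; split => //; exact: (oFC n).1.
  - by move=> y [By]; rewrite CS => -[].
  have [By|By] := pselect (closure (B i) y); last first.
    by exists 0; rewrite C0 setIT.
  have : ~ cluster F y by move=> Fy; apply: nclus; exists y.
  move=> /existsNP[M] /existsNP[O] /not_implyP[FM] /not_implyP[yO] MO.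
  have [_ /(_ y O yO)[k [Bky BkO]]] := baseB.
  (* [closure (B k)] lies in [O], which misses [M] in [F], so [C k.+1] removes it: the neighborhood
     [B k] of [y] misses the set of index [k.+1]. *)
  exists k.+1 => /(_ (B k)).
  case; first by apply: open_nbhs_nbhs; split => //; exact: base_open.
  move=> z [[_ Cz] Bkz]; apply: (Cz k) => //; last exact: subset_closure.
  apply: filterS FM => w Mw Bkw; apply: MO; exists w; split => //.
  exact: BkO.
by apply: subset_trans BiV; apply: closureS; exact: subIsetl.
Qed.

End Base.

(** * Existence of remote points *)

Lemma exists_arg_min (T : eqType) (f : T -> nat) (s : seq T) (x0 : T) :
  x0 \in s -> exists2 x, x \in s & forall y, y \in s -> (f x <= f y)%N.
Proof.
elim: s x0 => // a s IH x0 _.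
have [->|] := eqVneq s [::].
  by exists a => [|y]; rewrite inE// => /eqP ->.
case: s IH => // b s IH _; have [x xs xmin] := IH b (mem_head _ _).
have [ax|xa] := leqP (f a) (f x).
  exists a => [|y]; first exact: mem_head.
  by rewrite inE => /predU1P[->//|/xmin]; exact: leq_trans.
exists x => [|y]; first by rewrite inE xs orbT.
by rewrite inE => /predU1P[->|/xmin//]; exact: ltnW.
Qed.

Section Linked.
Variables (X : topologicalType) (B : nat -> set X).
Hypothesis baseB : regular_base B.

Definition avoids (A : set X) (j : nat) : Prop :=
  B j !=set0 /\ closure (B j) `&` closure A = set0.

Lemma avoiding_refine (A : set X) (i : nat) : nowhere_dense A ->
  B i !=set0 -> exists j, avoids A j /\ closure (B j) `<=` B i.
Proof.
move=> ndA Bi0; have oBi := base_open baseB i.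
have [||j [Bj0 BjU]] := base_refine baseB (U := B i `&` ~` closure A).
- by apply: openI => //; apply: closed_openC; exact: closed_closure.
- apply/set0P/eqP => /disjoints_subset; rewrite setCK => BA.
  have : interior (closure A) !=set0.
    by case: Bi0 => x Bx; exists x; apply: filterS BA _; exact: open_nbhs_nbhs.
  by rewrite ndA => -[].
exists j; split.
  split => //; apply/disjoints_subset; apply: subset_trans BjU _.
  exact: subIsetr.
exact: subset_trans BjU (@subIsetl _ _ _).
Qed.

(** Only finitely many indices lie below a bound, so the refinements chosen for all of them have a
    largest index, and the next bound can exceed it. *)
Lemma linked_bounds (i0 : nat) : exists m : set X -> nat -> nat,
  [/\ forall A, m A 0 = i0,
      forall A n, (m A n <= m A n.+1)%N
    & forall A n i, nowhere_dense A -> B i !=set0 -> (i <= m A n)%N ->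
      exists j, [/\ (j <= m A n.+1)%N, avoids A j & closure (B j) `<=` B i]].
Proof.
have /choice[c Hc] : forall Ai : set X * nat, exists j,
    nowhere_dense Ai.1 -> B Ai.2 !=set0 ->
    avoids Ai.1 j /\ closure (B j) `<=` B Ai.2.
  move=> [A i] /=; have [ndA|] := pselect (nowhere_dense A); last by exists 0.
  have [Bi0|] := pselect (B i !=set0); last by exists 0.
  by have [j Hj] := avoiding_refine ndA Bi0; exists j.
pose m A := fix m n := if n is k.+1
  then maxn (m k) (\max_(i < (m k).+1) c (A, i : nat)) else i0.
exists m; split=> [//|A n|A n i ndA Bi0 im]; first exact: leq_maxl.
have [cA cB] := Hc (A, i) ndA Bi0; exists (c (A, i)); split=> //=.
rewrite leq_max; apply/orP; right; rewrite -ltnS in im.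
exact: (leq_bigmax (F := fun i : 'I_(m A n).+1 => c (A, i : nat)) (Ordinal im)).
Qed.

(* Serve the sets of [L] in order of increasing bound: the index chosen for the
   one with the least [m _ s.+1] is admissible at stage [s.+1] for the others. *)
Lemma linked (m : set X -> nat -> nat)
    (mS : forall A n, (m A n <= m A n.+1)%N)
    (mP : forall A n i, nowhere_dense A -> B i !=set0 -> (i <= m A n)%N ->
      exists j, [/\ (j <= m A n.+1)%N, avoids A j & closure (B j) `<=` B i])
    (k s i : nat) (L : seq (set X)) :
  size L = k -> (forall A, A \in L -> nowhere_dense A) -> B i !=set0 ->
  (forall A, A \in L -> (i <= m A s)%N) ->
  exists j, [/\ B j !=set0, B j `<=` B i & forall A, A \in L ->
    exists j', [/\ (j' <= m A (s + k))%N, avoids A j',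
                   B j `<=` B j' & closure (B j') `<=` B i]].
Proof.
have mD A n p : (m A n <= m A (n + p))%N.
  by elim: p => [|p IH]; rewrite ?addn0// addnS; exact: leq_trans IH (mS _ _).
elim: k s i L => [|k IH] s i L sL ndL Bi0 iL.
  by exists i; split => // A; move/size0nil: sL => ->.
have [A0 A0L] : exists A0, A0 \in L.
  by case: L sL {ndL iL} => // A0 L _; exists A0; exact: mem_head.
have [A AL Amin] := exists_arg_min (fun A => m A s.+1) A0L.
have [j1 [j1m j1A j1B]] := mP A s i (ndL _ AL) Bi0 (iL _ AL).
have remL A' : A' \in rem A L -> A' \in L by exact: mem_rem.
have [|||| j [Bj0 jj1 jL]] := IH s.+1 j1 (rem A L).
- by rewrite size_rem// sL.
- by move=> A' /remL; exact: ndL.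
- by case: j1A.
- by move=> A' /remL /Amin; exact: leq_trans.
have j1i : B j1 `<=` B i by exact: subset_trans (@subset_closure _ _) j1B.
exists j; split => //; first exact: subset_trans jj1 j1i.
move=> A'; rewrite (perm_mem (perm_to_rem AL)) inE => /predU1P[->|/jL].
  exists j1; split => //.
  by rewrite addnS -addSn; exact: leq_trans j1m (mD _ _ _).
move=> [j' [j'm j'A jj' j'j]]; exists j'; split => //.
  by rewrite addnS -addSn.
exact: subset_trans j'j j1i.
Qed.

End Linked.

(** Models the Cech-Stone compactification of a normal space, which the last clause singles out
    among compactifications. *)
Definition normal_compactification (X K : topologicalType) (e : X -> K)
    : Prop :=
  [/\ continuous e, compact [set: K], hausdorff_space K,
      forall p, closure (range e) p
    & forall A B, closed A -> closed B -> A `&` B = set0 ->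
        closure (e @` A) `&` closure (e @` B) = set0].

Definition remote (X K : topologicalType) (e : X -> K) : set K :=
  [set p | ~ range e p /\
    forall A, nowhere_dense A -> ~ closure (e @` A) p].

Lemma decreasing_le (X : Type) (W : nat -> set X) (n m : nat) :
  (forall n, W n.+1 `<=` W n) -> (n <= m)%N -> W m `<=` W n.
Proof.
move=> WS /subnKC <-; elim: (m - n)%N => [|k IH]; first by rewrite addn0.
by rewrite addnS; exact: subset_trans (WS _) IH.
Qed.

Section Remote.
Variables (X K : topologicalType) (e : X -> K) (B : nat -> set X).
Hypotheses (baseB : regular_base B) (cpt_e : normal_compactification e).

(* Van Douwen's construction: for any [n] nowhere dense sets [A], the finite
   unions of the [B j] with [j <= m n A n] avoiding [A] have a common point
   inside [W n]. So the closed sets [F A] have the finite intersection property, even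
   along [W], and a common cluster point is remote. *)
Lemma remote_in_vanishing (W : nat -> set X) : vanishing W ->
  exists2 p, remote e p & forall n, closure (e @` W n) p.
Proof.
case: cpt_e => ce cK hK _ sepe [oW W0 WS Wx].
have [i0 Hi0] := choice (fun n => base_refine baseB (oW n) (W0 n)).
have [m Hm] := choice (fun n => linked_bounds baseB (i0 n)).
pose P A n j := [/\ (j <= m n A n)%N, avoids B A j & closure (B j) `<=` W n].
pose F A := [set x | exists n j, P A n j /\ closure (B j) x].
have FA0 A : F A `&` closure A = set0.
  rewrite -subset0 => x [[n [j [[_ [_ BA] _] Bx]]] Ax].
  by rewrite -BA.
(* Pieces with [n >= N] lie in [W N], and the bounds [m n A n] leave finitely many others. So off
   [closure (W N)] the set [F A] agrees with a finite union of closed sets. *)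
have cF A : closed (F A).
  move=> x clFx; have [N WNx] := Wx x.
  pose G := \bigcup_(n in `I_N)
    \bigcup_(j in [set j | (j < (m n A n).+1)%N /\ P A n j]) closure (B j).
  have cG : closed G.
    apply: closed_bigcup; first exact: finite_II.
    move=> n _; apply: closed_bigcup; last by move=> j _; exact: closed_closure.
    by apply: sub_finite_set (finite_II (m n A n).+1) => j [].
  have FG : F A `<=` W N `|` G.
    move=> y [n [j [Pj Bjy]]]; have [Nn|nN] := leqP N n.
      by left; apply: decreasing_le Nn _ _ => //; case: Pj => _ _; apply.
    by right; exists n => //; exists j => //; split => //; case: Pj.
  have := closureS FG clFx; rewrite closureU => -[//|/cG].
  by case=> n _ [j [_ Pj] Bx]; exists n, j.
pose D := [set Ln : seq (set X) * nat |
  forall A, A \in Ln.1 -> nowhere_dense A].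
pose b (Ln : seq (set X) * nat) :=
  [set x | (forall A, A \in Ln.1 -> F A x) /\ W Ln.2 x].
have PF : ProperFilter (filter_from D b).
  apply: filter_from_proper.
    apply: filter_from_filter; first by exists ([::], 0) => A.
    move=> [L1 n1] [L2 n2] /= D1 D2; exists (L1 ++ L2, maxn n1 n2).
      by move=> A; rewrite mem_cat => /orP[/D1|/D2].
    move=> x [FL Wn]; split; split => //=.
    - by move=> A AL; apply: FL; rewrite mem_cat AL.
    - exact: decreasing_le WS (leq_maxl _ _) _ Wn.
    - by move=> A AL; apply: FL; rewrite mem_cat AL orbT.
    - exact: decreasing_le WS (leq_maxr _ _) _ Wn.
  (* [N >= size L] makes the bound [m N A N] large enough for [size L] successive refinements;
     [N >= n] puts the result in [W n]. *)
  move=> [L n] DL; pose N := maxn n (size L).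
  have [m0 mS mP] := Hm N; have [Bi0 BW] := Hi0 N.
  have [|j [[x Bjx] Bj BL]] := linked mS mP (s := 0) (erefl (size L)) DL Bi0.
    by move=> A _; rewrite m0.
  have mD A k p : (m N A k <= m N A (k + p))%N.
    by elim: p => [|p IH]; rewrite ?addn0// addnS; exact: leq_trans IH (mS _ _).
  exists x; split=> [A /BL[j' [j'm j'A jj' j'B]]|].
    exists N, j'; split; last exact/subset_closure/jj'.
    split => //.
      apply: leq_trans j'm _; rewrite add0n.
      by have := mD A (size L) (N - size L)%N; rewrite subnKC// leq_maxr.
    by apply: subset_trans j'B (subset_trans (@subset_closure _ _) BW).
  apply: decreasing_le WS (leq_maxl n (size L)) _ _.
  exact/BW/subset_closure/Bj.
have [p [_]] := cK _ (fmap_proper_filter e PF) (@filterT _ _ _).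
rewrite clusterE => clp.
have clF A : nowhere_dense A -> closure (e @` F A) p.
  move=> ndA; apply: clp; exists ([:: A], 0) => [A'|x [/= FA _]].
    by rewrite inE => /eqP ->.
  by exists x => //; apply: FA; rewrite inE.
have clW n : closure (e @` W n) p.
  by apply: clp; exists ([::], n) => [A'//|x [_ /= Wnx]]; exists x.
have cleW n : closure (e @` closure (W n)) p.
  by apply: closureS (clW n); apply: image_subset; exact: subset_closure.
exists p => //; split.
  move=> [x _ exp]; have [n Wnx] := Wx x.
  have cx0 : closure [set x] `&` closure (W n) = set0.
    apply/disjoints_subset.
    have [_ /(_ x (~` closure (W n)))] := baseB.
    case; first by apply: open_nbhs_nbhs; split => //;
      exact/closed_openC/closed_closure.
    move=> i [Bix BiW]; apply: subset_trans BiW; apply: closureS.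
    by move=> _ ->.
  have := sepe _ _ (@closed_closure _ _) (@closed_closure _ _) cx0.
  rewrite -subset0; apply; split; last exact: (cleW n).
  by apply: subset_closure; exists x => //; exact: subset_closure.
move=> A ndA Ap.
have := sepe _ _ (cF A) (@closed_closure _ A) (FA0 A).
rewrite -subset0; apply; split; first exact: (clF A ndA).
by apply: closureS Ap; apply: image_subset; exact: subset_closure.
Qed.

(** A vanishing sequence starting well inside [V] yields [p]; its first closure and the complement
    of [V] are disjoint closed sets, hence stay apart in [K]. The conclusion is an open condition on
    [p], as continuity arguments require. *)
Lemma remote_dense (V : set X) : nowhere_locally_compact X -> open V ->
  V !=set0 -> exists2 p, remote e p & ~ closure (e @` (~` V)) p.
Proof.
move=> nlc oV V0; have [W vW WV] := vanishing_exists baseB nlc oV V0.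
have [p rp Wp] := remote_in_vanishing vW; exists p => // Vp.
case: cpt_e => _ _ _ _ sepe.
have WV0 : closure (W 0) `&` ~` V = set0.
  by apply/disjoints_subset; rewrite setCK.
have := sepe _ _ (@closed_closure _ (W 0)) (open_closedC oV) WV0.
rewrite -subset0; apply; split; last exact: Vp.
by apply: closureS (Wp 0); apply: image_subset; exact: subset_closure.
Qed.

(** The [U n] shrink to [x], so continuity of [e] and the Hausdorff property force [p] to be [e x],
    which is not remote. *)
Lemma remote_not_shrinking (U : nat -> set X) (x : X) (p : K) :
  remote e p -> (forall n, decides B n (U n)) -> (forall n, U n x) ->
  (forall n, closure (e @` U n) p) -> False.
Proof.
case: cpt_e => ce _ hK _ _ [px _] dU Ux Up; apply: px; exists x => //.
apply: esym; apply: hK => M O pM xO.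
have [n UO] := decides_nbhs baseB dU Ux (ce x O xO).
by have [_ [[y Uy <-] My]] := Up n M pM; exists (e y); split => //; exact: UO.
Qed.

Lemma closure_imageC (V : set X) (p : K) :
  ~ closure (e @` (~` V)) p -> closure (e @` V) p.
Proof.
case: cpt_e => _ _ _ de _ Vp.
have : closure (e @` V `|` e @` (~` V)) p.
  by rewrite -image_setU setUv; exact: de.
by rewrite closureU => -[].
Qed.

End Remote.

(** * Transfer along a homeomorphism of remote points *)

Definition leads (X Y K L : topologicalType) (eX : X -> K) (eY : Y -> L)
    (f : set_type (remote eX) -> set_type (remote eY)) (U : set X) (V : set Y)
    : Prop :=
  forall p, closure (eX @` U) (\val p) -> closure (eY @` V) (\val (f p)).

Section Leads.
Variables (X Y K L : topologicalType) (eX : X -> K) (eY : Y -> L).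
Variables (f : set_type (remote eX) -> set_type (remote eY)).
Variables (g : set_type (remote eY) -> set_type (remote eX)).

Lemma leads_subl (U U' : set X) (V : set Y) :
  U' `<=` U -> leads f U V -> leads f U' V.
Proof.
by move=> sub UV p Up; apply: UV; apply: closureS Up; exact: image_subset.
Qed.

Lemma leads_setT (U : set X) : normal_compactification eY -> leads f U setT.
Proof. by move=> [_ _ _ de _] p _; exact: de. Qed.

(** Take a remote [q] deep inside [V]. Then [g q] is in the closure of [U], and by continuity [f]
    maps the remote points near [g q] deep into [V]; so [U] is cut down to a neighborhood of
    [g q]. *)
Lemma leads_refine (BY : nat -> set Y) (U : set X) (V : set Y) :
  normal_compactification eX -> normal_compactification eY ->
  regular_base BY -> nowhere_locally_compact Y ->
  continuous f -> cancel g f ->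
  open U -> open V -> V !=set0 -> leads g V U ->
  exists U', [/\ open U', U' !=set0, U' `<=` U & leads f U' V].
Proof.
move=> cX cY baseY nlcY cf gK oU oV V0 VU.
have [q rq Vq] := remote_dense baseY cY nlcY oV V0.
pose q' : set_type (remote eY) := exist _ q (mem_set rq).
have Uq : closure (eX @` U) (\val (g q')).
  by apply: VU; exact: (closure_imageC cY Vq).
have : nbhs (g q') (f @^-1` [set r | ~ closure (eY @` (~` V)) (\val r)]).
  apply: cf; rewrite gK; apply: open_nbhs_nbhs; split => //.
  exists (~` closure (eY @` (~` V))) => //.
  exact/closed_openC/closed_closure.
case=> _ [[O oO <-] /= Oq OV].
have [ceX cK hK deX _] := cX.
(* [leads] speaks of closures, so a neighborhood whose closure lies in [O] is required. *)
have regK := compact_regular (x := \val (g q')) hK cK (@filterT _ _ _).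
have [O1 O1q clO1] : filter_from (nbhs (\val (g q'))) closure O.
  by apply: regK; exact: open_nbhs_nbhs.
have [z [[x Ux <-] O1x]] := Uq _ (nbhs_interior O1q).
exists (U `&` eX @^-1` (interior O1)); split.
- apply: openI => //; apply: open_comp; last exact: open_interior.
  by move=> y _; exact: ceX.
- by exists x.
- exact: subIsetl.
move=> p Up; apply: (closure_imageC cY); apply: OV; apply: clO1.
apply: closureS Up => _ [y [_ O1y] <-]; exact: interior_subset.
Qed.

End Leads.

Section Transfer.
Variables (X Y K L : topologicalType) (eX : X -> K) (eY : Y -> L).
Variables (BX : nat -> set X) (BY : nat -> set Y).
Hypotheses (baseX : regular_base BX) (baseY : regular_base BY).
Hypotheses (cX : normal_compactification eX) (cY : normal_compactification eY).
Hypotheses (nlcX : nowhere_locally_compact X).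
Hypotheses (nlcY : nowhere_locally_compact Y).
Variables (f : set_type (remote eX) -> set_type (remote eY)).
Variables (g : set_type (remote eY) -> set_type (remote eX)).
Hypotheses (cf : continuous f) (cg : continuous g).
Hypotheses (fK : cancel f g) (gK : cancel g f).

Lemma leads_refine_decides (n : nat) (U : set X) (V : set Y) :
  open U -> open V -> V !=set0 -> leads g V U ->
  exists U', [/\ open U', U' !=set0, U' `<=` U, leads f U' V & decides BX n U'].
Proof.
move=> oU oV V0 VU.
have [U0 [oU0 U00 U0U U0V]] := leads_refine cX cY baseY nlcY cf gK oU oV V0 VU.
have [U1 [oU1 U10 U1U0 dU1]] := decides_exists baseX n oU0 U00.
exists U1; split => //; first exact: subset_trans U0U.
exact: leads_subl U0V.
Qed.

(** Nested closures ensure that a sequence with empty intersection is [vanishing]. *)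
Lemma leads_refine_closure (U : set X) (V : set Y) :
  open U -> U !=set0 -> open V -> leads f U V ->
  exists V', [/\ open V', V' !=set0, closure V' `<=` V & leads g V' U].
Proof.
move=> oU U0 oV UV.
have [V0 [oV0 V00 V0V V0U]] := leads_refine cY cX baseX nlcX cg fK oV oU U0 UV.
have [i [Bi0 BiV]] := base_refine baseY oV0 V00.
exists (BY i); split => //; first exact: base_open.
- exact: subset_trans BiV V0V.
- by apply: leads_subl V0U; apply: subset_trans BiV; exact: subset_closure.
Qed.

Lemma choquet_transfer : choquet_space X -> choquet_space Y.
Proof.
move=> [s [s_legal s_wins]].
(* Choices fixed in advance make the simulated game in [X] a function of the moves seen in [Y];
   [set0] is a default when the premises fail. *)
have /choice[pickU HU] : forall t : nat * set X * set Y, exists U',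
    open t.1.2 -> open t.2 -> t.2 !=set0 -> leads g t.2 t.1.2 ->
    [/\ open U', U' !=set0, U' `<=` t.1.2, leads f U' t.2 &
        decides BX t.1.1 U'].
  move=> [[n U] V] /=; case: (pselect (open U)); last by exists set0.
  case: (pselect (open V)); last by exists set0.
  case: (pselect (V !=set0)); last by exists set0.
  case: (pselect (leads g V U)); last by exists set0.
  move=> VU V0 oV oU.
  by have [U' HU'] := leads_refine_decides n oU oV V0 VU; exists U'.
have /choice[pickV HV] : forall t : set X * set Y, exists V',
    open t.1 -> t.1 !=set0 -> open t.2 -> leads f t.1 t.2 ->
    [/\ open V', V' !=set0, closure V' `<=` t.2 & leads g V' t.1].
  move=> [U V] /=; case: (pselect (open U)); last by exists set0.
  case: (pselect (U !=set0)); last by exists set0.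
  case: (pselect (open V)); last by exists set0.
  case: (pselect (leads f U V)); last by exists set0.
  move=> UV oV U0 oU.
  by have [V' HV'] := leads_refine_closure oU U0 oV UV; exists V'.
pose answerX us := if us is [::] then setT else s us.
(* The simulated move of I in [X] stays inside the last answer of [s]; [size us] is the stage, hence
   the number up to which it decides [BX]. *)
pose move us V := pickU (size us, answerX us, V).
pose step us V := rcons us (move us V).
pose history (Vs : seq (set Y)) := foldl step [::] Vs.
pose t Vs := pickV (s (history Vs), last setT Vs).
pose hist V n := history (mkseq V n).
pose U V n := move (hist V n) (V n).
have histS V n : hist V n.+1 = rcons (hist V n) (U V n).
  by rewrite /hist /history mkseqS foldl_rcons.
have histE V n : hist V n = mkseq (U V) n.
  by elim: n => // n IH; rewrite histS IH -mkseqS.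
have ansE V n : choquet_answer t V n = pickV (choquet_answer s (U V) n, V n).
  rewrite /choquet_answer /t -/(hist V n.+1) histE.
  by rewrite [mkseq V _]mkseqS last_rcons.
have run V n : (forall k, (k <= n)%N -> choquet_move_I t V k) ->
    [/\ choquet_move_I s (U V) n /\ choquet_move_II s (U V) n,
        decides BX n (U V n), choquet_move_II t V n,
        closure (choquet_answer t V n) `<=` V n
      & leads g (choquet_answer t V n) (choquet_answer s (U V) n)].
  (* Strong induction: [s_legal] asks for the legality of all earlier simulated moves. *)
  elim/ltn_ind: n => n IH legal.
  have [oV V0 VS] := legal n (leqnn n).
  pose A := answerX (hist V n).
  have [oA VA AE] : [/\ open A, leads g (V n) A &
      forall m, n = m.+1 -> A = choquet_answer s (U V) m].
    rewrite /A histE; case: n IH legal oV V0 VS {A} => [|n] IH legal oV V0 VS.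
      by split => //; [exact: openT|exact: leads_setT].
    have [|[_ [os _ _]] _ _ _ lead] := IH n (leqnn _).
      by move=> k kn; apply: legal; exact: leqW.
    have -> : answerX (mkseq (U V) n.+1) = choquet_answer s (U V) n by [].
    split => //; last by move=> m [->].
    by apply: leads_subl lead; exact: VS.
  have [oU U0 UA UV dU] := HU (size (hist V n), A, V n) oA oV V0 VA.
  have mI : choquet_move_I s (U V) n.
    by split => // m nm; rewrite -(AE m nm).
  have [os s0 sU] : choquet_move_II s (U V) n.
    apply: s_legal => k; rewrite leq_eqVlt => /predU1P[->//|kn].
    have [|[//]] := IH k kn; move=> j jk; apply: legal.
    by rewrite (leq_trans jk)// ltnW.
  have sV : leads f (choquet_answer s (U V) n) (V n) by exact: leads_subl UV.
  have := HV (choquet_answer s (U V) n, V n) os s0 oV sV.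
  rewrite -ansE => -[ot t0 tV lead]; split => //.
  - have sh : size (hist V n) = n by rewrite histE size_mkseq.
    by rewrite -[X in decides _ X _]sh.
  - by split => //; apply: subset_trans tV; exact: subset_closure.
exists t; split=> [V n legal|V legal]; first by have [] := run V n legal.
have {}run n := run V n (fun k _ => legal k).
apply: contrapT => none.
have van : vanishing (choquet_answer t V).
  split=> [n|n|n|y].
  - by have [_ _ []] := run n.
  - by have [_ _ []] := run n.
  - have [_ _ [_ _ tV] _ _] := run n.+1.
    by apply: subset_trans tV _; have [_ _ +] := legal n.+1; exact.
  (* A point in all closures lies in every [V n.+1], hence in every answer. *)
  apply: contrapT => /forallNP ty; apply: none; exists y => n _.
  have [_ _ +] := legal n.+1; apply => //.
  by have [_ _ _ + _] := run n.+1; apply; exact: contrapT.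
have [q rq tq] := remote_in_vanishing baseY cY van.
have [x sx] := s_wins (U V) (fun n => let: And5 mI _ _ _ _ := run n in mI.1).
pose q' : set_type (remote eY) := exist _ q (mem_set rq).
apply: (remote_not_shrinking baseX cX (U := U V) (x := x) (p := \val (g q'))).
- by have := valP (g q'); rewrite inE.
- by move=> n; have [_ +] := run n.
- by move=> n; have [[_ [_ _ sU]] _ _ _ _] := run n; apply: sU; exact: sx.
move=> n; have [[_ [_ _ sU]] _ _ _ lead] := run n.
by apply: closureS (lead q' (tq n)); exact: image_subset.
Qed.

Lemma meager_transfer : meager_space X -> meager_space Y.
Proof.
move=> [F [ndF FT]].
pose valid (st : set X * set Y) :=
  [/\ open st.1, open st.2 & leads g st.2 st.1].
have /choice[next Hnext] : forall a : (set X * set Y) * nat * nat, exists st',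
    valid a.1.1 -> valid st' /\ (a.1.1.2 `&` BY a.2 !=set0 ->
    [/\ st'.1 !=set0, st'.1 `<=` a.1.1.1, closure st'.1 `&` F a.1.2 = set0,
        st'.2 !=set0 & exists V, [/\ st'.2 `<=` V, V `<=` a.1.1.2 `&` BY a.2,
          decides BY a.1.2 V & leads f st'.1 V]]).
  move=> [[[U V] n] k] /=.
  have [[oU oV VU]|nv] := pselect (valid (U, V)); last by exists (U, V).
  (* If [V] misses [BY k], the position is repeated, so that every list yields a valid one. *)
  have [VB|VB] := pselect (V `&` BY k !=set0); last by exists (U, V).
  have oVB : open (V `&` BY k) by apply: openI => //; exact: base_open.
  have [V1 [oV1 V10 V1V dV1]] := decides_exists baseY n oVB VB.
  have V1U : leads g V1 U.
    by apply: leads_subl VU; apply: subset_trans V1V _; exact: subIsetl.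
  have [U0 [oU0 U00 U0U U0V1]] :=
    leads_refine cX cY baseY nlcY cf gK oU oV1 V10 V1U.
  have U0F : U0 `&` ~` closure (F n) !=set0.
    apply/set0P/eqP => /disjoints_subset; rewrite setCK => UF.
    have : interior (closure (F n)) !=set0.
      case: U00 => x U0x; exists x; apply: filterS UF _.
      exact: open_nbhs_nbhs.
    by rewrite ndF => -[].
  have oU0F : open (U0 `&` ~` closure (F n)).
    by apply: openI => //; apply: closed_openC; exact: closed_closure.
  have [i [Bi0 BiU]] := base_refine baseX oU0F U0F.
  have BiU0 : BX i `<=` U0.
    by move=> x /subset_closure /BiU [].
  have BiV1 : leads f (BX i) V1 by exact: leads_subl U0V1.
  have [V2 [oV2 V20 V2V1 V2B]] :=
    leads_refine_closure (base_open baseX i) Bi0 oV1 BiV1.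
  exists (BX i, V2) => _; split.
    by split => //; exact: base_open.
  move=> _; split => //=.
  - exact: subset_trans U0U.
  - apply/disjoints_subset; apply: subset_trans BiU _ => x [_ nF] Fx.
    exact/nF/subset_closure.
  exists V1; split => //.
  by apply: subset_trans V2V1; exact: subset_closure.
(* Tree of positions: the latest choice is at the head of the list, and the level [size l'] selects
   the set [F] to avoid. *)
pose pos := fix pos (l : seq nat) := if l is k :: l'
  then next (pos l', size l', k) else (setT, setT).
have valid_pos l : valid (pos l).
  elim: l => [|k l IH] /=; last by have [] := Hnext (pos l, size l, k) IH.
  by split; [exact: openT|exact: openT|exact: leads_setT].
have pos_step l k := (Hnext (pos l, size l, k) (valid_pos l)).2.
(* Open and dense: any basic open set inside the position contains the nonempty second component of
   one of its children. *)
pose D l := ~` closure (pos l).2 `|`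
  [set y | exists2 k, (pos l).2 `&` BY k !=set0 & (pos (k :: l)).2 y].
have oD l : open (D l).
  apply: openU; first exact/closed_openC/closed_closure.
  rewrite openE => y [k Vk yk]; have [_ oV _] := valid_pos (k :: l).
  apply: filterS (open_nbhs_nbhs (conj oV yk)) => z zk.
  by exists k.
have ndD l : nowhere_dense (~` D l).
  rewrite /nowhere_dense; move/open_closedC/closure_id : (oD l) => <-.
  rewrite -subset0 => y yD.
  have Vy : closure (pos l).2 y.
    by apply: contrapT => nVy; apply: (interior_subset yD); left.
  have [z Vz] := Vy _ (nbhs_interior yD).
  have [||k [[w Bw] BV]] :=
    base_refine baseY (U := (pos l).2 `&` interior (~` D l)).
  - by apply: openI; [case: (valid_pos l)|exact: open_interior].
  - by exists z.
  have BVw v : BY k v -> ((pos l).2 `&` interior (~` D l)) v.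
    by move=> /subset_closure /BV.
  have Vk : (pos l).2 `&` BY k !=set0.
    by exists w; split => //; exact: (BVw w Bw).1.
  have [_ _ _ [v kv] [V1 [kV1 V1V _ _]]] := pos_step l k Vk.
  have [_ Bv] := V1V _ (kV1 _ kv).
  by apply: (interior_subset (BVw v Bv).2); right; exists k.
(* There are countably many lists; numbers that code no list receive [set0]. *)
exists (fun n => if unpickle n is Some l then ~` D l else set0); split.
  move=> n; case: (unpickle n) => [l|]; first exact: ndD.
  by rewrite /nowhere_dense closure0 interior0.
apply/seteqP; split => // y _; apply: contrapT => nmeager.
have Dy l : D l y.
  apply: contrapT => nDy; apply: nmeager; exists (pickle l) => //.
  by rewrite pickleK.
(* A point [y] of every [D l] starts in [setT] at the root and can always pass to a child, which
   gives a branch. *)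
have /choice[nxt Hnxt] : forall l, exists k, (pos l).2 y ->
    (pos l).2 `&` BY k !=set0 /\ (pos (k :: l)).2 y.
  move=> l; have [ly|] := pselect ((pos l).2 y); last by exists 0.
  case: (Dy l) => [nly|[k Vk ky]]; last by exists k.
  by exfalso; apply: nly; exact: subset_closure.
pose br := fix br n := if n is m.+1 then nxt (br m) :: br m else [::].
have size_br n : size (br n) = n by elim: n => //= n ->.
have bry n : (pos (br n)).2 y by elim: n => // n /Hnxt[].
have brV n : (pos (br n)).2 `&` BY (nxt (br n)) !=set0.
  by have [] := Hnxt _ (bry n).
have step n := pos_step (br n) (nxt (br n)) (brV n).
(* The [F n] cover [X], and the closure of the first component at level [n.+1] misses [F n]. *)
have van : vanishing (fun n => (pos (br n.+1)).1).
  split=> [n|n|n|x].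
  - by have [] := valid_pos (br n.+1).
  - by have [] := step n.
  - by have [] := step n.+1.
  have [n _ Fx] : (\bigcup_n F n) x by rewrite FT.
  exists n; have [_ _ + _ _] := step n.
  by rewrite /= size_br -subset0 => clF clx; apply: (clF x).
have [p rp Up] := remote_in_vanishing baseX cX van.
pose p' : set_type (remote eX) := exist _ p (mem_set rp).
(* The first component leads to the intermediate set [V], not to the smaller second component; [V]
   still contains [y] and decides [BY]. *)
have /choice[V1 HV1] : forall n, exists V, [/\ decides BY n V, V y &
    leads f (pos (br n.+1)).1 V].
  move=> n; have [_ _ _ _ [V [kV _ dV fV]]] := step n.
  have dnV : decides BY n V by move: dV; rewrite /= size_br.
  by exists V; split => //; apply: kV; exact: (bry n.+1).
apply: (remote_not_shrinking baseY cY (U := V1) (x := y) (p := \val (f p'))).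
- by have := valP (f p'); rewrite inE.
- by move=> n; have [] := HV1 n.
- by move=> n; have [] := HV1 n.
- by move=> n; have [_ _] := HV1 n; apply; exact: Up.
Qed.

End Transfer.

(** * Separable metrizable spaces and their Cech-Stone compactification *)

Local Open Scope ring_scope.

Lemma nbhs_set_type (T : topologicalType) (A : set T) (p : set_type A)
    (O : set T) : nbhs (\val p) O -> nbhs p (\val @^-1` O).
Proof. exact: initial_continuous. Qed.

Lemma compact_set_type (T : topologicalType) (A : set T) :
  compact A -> compact [set: set_type A].
Proof.
move=> cA F PF _.
have FA : F (\val @^-1` A) by apply: filterE => p; exact: set_valP.
have [x [Ax clx]] := cA _ (fmap_proper_filter \val PF) FA.
exists (exist _ x (mem_set Ax)); split => // M N FM [_ [[O oO <-] /= Ox ON]].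
have FM' : F (\val @^-1` (\val @` M)) by apply: filterS FM => p Mp; exists p.
have [_ [[p Mp <-] Op]] := clx _ _ FM' (open_nbhs_nbhs (conj oO Ox)).
by exists p; split => //; exact: ON.
Qed.

Lemma hausdorff_set_type (T : topologicalType) (A : set T) :
  hausdorff_space T -> hausdorff_space (set_type A).
Proof.
move=> hT p q clpq; apply: val_inj; apply: hT => M N pM qN.
have [r [Mr Nr]] := clpq _ _ (nbhs_set_type pM) (nbhs_set_type qN).
by exists (\val r).
Qed.

Section StoneCech.
Variables (R : realType) (X : topologicalType).

Lemma unit_interval_compact : compact [set: unit_interval R].
Proof. by apply: compact_set_type; exact: segment_compact. Qed.

Lemma unit_interval_hausdorff : hausdorff_space (unit_interval R).
Proof. by apply: hausdorff_set_type; exact: Rhausdorff. Qed.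

Lemma stone_cech_compact : compact [set: stone_cech R X].
Proof.
apply: compact_set_type; apply: (@subclosed_compact _ _ setT) => //.
  exact: closed_closure.
have := @tychonoff _ (fun _ : continuousType X (unit_interval R) =>
  unit_interval R) (fun _ => setT) (fun _ => unit_interval_compact).
by congr compact; apply/seteqP; split.
Qed.

Lemma stone_cech_hausdorff : hausdorff_space (stone_cech R X).
Proof.
apply: hausdorff_set_type; apply: hausdorff_product => _.
exact: unit_interval_hausdorff.
Qed.

Lemma to_stone_cech_continuous : continuous (@to_stone_cech R X).
Proof.
apply: continuous_comp_initial => x; apply/cvg_sup => f U.
move=> [_ [[V oV <-] /= Vfx]] /filterS; apply.
have : nbhs (f x) V by exact: open_nbhs_nbhs.
exact: cts_fun.
Qed.

Lemma to_stone_cech_dense (p : stone_cech R X) :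
  closure (range (@to_stone_cech R X)) p.
Proof.
move=> N [_ [[O oO <-] /= Op ON]].
have [_ [[x _ <-] Ox]] := set_valP p O (open_nbhs_nbhs (conj oO Op)).
by exists (to_stone_cech R x); split; [exists x|exact: ON].
Qed.

(** A Urysohn function for [A] and [B] is a coordinate of the cube, hence extends continuously and
    stays 0 and 1 on the two closures. *)
Lemma stone_cech_separates (A B : set X) : normal_space X ->
  closed A -> closed B -> A `&` B = set0 ->
  closure (@to_stone_cech R X @` A) `&` closure (@to_stone_cech R X @` B)
    = set0.
Proof.
move=> /(@normal_separatorP R X) nX cA cB AB0.
have /(@uniform_separatorP _ R)[f [cf f01 fA fB]] := nX A B cA cB AB0.
have f01' x : f x \in `[0 : R, 1 : R]%classic.
  by rewrite inE; apply: f01; exists x.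
pose g x : unit_interval R := exist _ (f x) (f01' x).
have cg : continuous g by apply: continuous_comp_initial; exact: cf.
pose G : continuousType X (unit_interval R) := mkcts cg.
pose k (p : stone_cech R X) : R := \val ((\val p : stone_cech_cube R X) G).
have ck : continuous k.
  move=> p; apply: (@continuous_comp _ _ _
    (fun p : stone_cech R X => (\val p : stone_cech_cube R X) G) \val);
    last exact: initial_continuous.
  apply: (@continuous_comp _ _ _ (\val : stone_cech R X -> stone_cech_cube R X)
    (fun q : stone_cech_cube R X => q G)); first exact: initial_continuous.
  exact: (@proj_continuous _ (fun _ : continuousType X (unit_interval R) =>
    unit_interval R) G).
have kE (C : set X) (c : R) (p : stone_cech R X) : f @` C `<=` [set c] ->
    closure (@to_stone_cech R X @` C) p -> k p = c.
  move=> fC Cp.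
  have clk : closed (k @^-1` [set c]).
    by apply: preimage_closed => [q _|]; [exact: ck|exact: closed_eq].
  apply: clk; apply: closureS Cp => _ [x Cx <-]; apply: fC.
  by exists x.
rewrite -subset0 => p [/(kE _ _ _ fA) k0 /(kE _ _ _ fB) k1].
by have := oner_neq0 R; rewrite -k1 k0 eqxx.
Qed.

Lemma stone_cech_normal_compactification : normal_space X ->
  normal_compactification (@to_stone_cech R X).
Proof.
move=> nX; split.
- exact: to_stone_cech_continuous.
- exact: stone_cech_compact.
- exact: stone_cech_hausdorff.
- exact: to_stone_cech_dense.
- by move=> A B; exact: stone_cech_separates.
Qed.

End StoneCech.

Section Metrizable.
Variables (R : realType) (X : topologicalType) (dist : X -> X -> R).
Hypotheses (dist_eq0 : forall x y, dist x y = 0 <-> x = y)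
  (distC : forall x y, dist x y = dist y x)
  (dist_triangle : forall x y z, dist x z <= dist x y + dist y z)
  (nbhs_dist : forall x (A : set X),
    nbhs x A <-> exists2 e, 0 < e & [set y | dist x y < e] `<=` A).

Lemma dist_ball_open (x : X) (r : R) : open [set y | dist x y < r].
Proof.
rewrite openE => y /= xy; apply/nbhs_dist; exists (r - dist x y).
  by rewrite subr_gt0.
move=> z /=; rewrite ltrBrDl; apply: le_lt_trans; exact: dist_triangle.
Qed.

Lemma dist_ball_center (x : X) (r : R) : 0 < r -> dist x x < r.
Proof. by rewrite (dist_eq0 x x).2. Qed.

(** Each ball has at most half the distance from its center to the other set as radius, so balls
    from opposite sides cannot meet. *)
Lemma metrizable_normal : normal_space X.
Proof.
apply/(@normal_openP R) => A B cA cB AB0.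
pose side (C C' : set X) := \bigcup_(r in [set r : X * R | C r.1 /\
   forall z, C' z -> r.2 *+ 2 <= dist r.1 z]) [set y | dist r.1 y < r.2].
have side_open C C' : open (side C C').
  by apply: bigcup_open => r _; exact: dist_ball_open.
have side_sub C C' : closed C' -> C `&` C' = set0 -> C `<=` side C C'.
  move=> clC' CC' x Cx.
  have /nbhs_dist[r r0 rC'] : nbhs x (~` C').
    apply: open_nbhs_nbhs; split; first exact: closed_openC.
    by move=> C'x; have : (C `&` C') x by []; rewrite CC'.
  exists (x, r / 2) => /=; last by apply: dist_ball_center; lra.
  split=> // z C'z; rewrite leNgt; apply/negP => xz.
  by apply: (rC' z) => //=; lra.
exists (side A B), (side B A); split => //.
- exact: side_sub.
- by apply: side_sub; rewrite // setIC.
rewrite -subset0 => y [[[a r] /= [Aa ra] ay] [[b s] /= [Bb sb] bs]].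
have := ra _ Bb; have := sb _ Aa; have := dist_triangle a y b.
by move: ay bs; rewrite (distC b a) (distC b y) !mulr2n; lra.
Qed.

(** Balls of radius [k.+1%:R^-1] around a countable dense set, indexed by the code of the pair of
    center and [k]. As [h] is injective on [D], each union is one ball or empty. *)
Lemma metrizable_regular_base : separable_space X ->
  exists B : nat -> set X, regular_base B.
Proof.
move=> [D [/countable_injP[h hinj] dD]].
pose B i := if (unpickle i : option (nat * nat)) is Some (a, k)
  then \bigcup_(x in [set x | D x /\ h x = a]) [set y | dist x y < k.+1%:R^-1]
  else set0.
exists B; split.
  move=> i; rewrite /B; case: (unpickle i) => [[a k]|]; last exact: open0.
  by apply: bigcup_open => x _; exact: dist_ball_open.
move=> x O /nbhs_dist[e e0 eO].
(* A point [y] of the closure is reached from [x] through [z] and [w] in three steps shorter than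
   [e / 4]. *)
have e4 : 0 < e / 4 by lra.
have [k ke] := filter_ex (near_infty_natSinv_lt (PosNum e4)).
rewrite /= in ke.
have k0 : 0 < k.+1%:R^-1 :> R by rewrite invr_gt0.
have [z [/= xz Dz]] : [set y | dist x y < k.+1%:R^-1] `&` D !=set0.
  by apply: dD; [exists x; exact: dist_ball_center|exact: dist_ball_open].
exists (pickle (h z, k)); rewrite /B pickleK; split.
  by exists z => //=; rewrite distC.
move=> y clBy; apply: eO => /=.
have [|w [[z' [Dz' hz'] /= z'w] /= yw]] := clBy [set w | dist y w < e / 4].
  by apply/nbhs_dist; exists (e / 4).
have zz : z' = z by apply: hinj; rewrite ?inE.
have := dist_triangle x z y; have := dist_triangle z w y.
move: (lt_trans z'w ke) (lt_trans xz ke) yw; rewrite zz (distC y w).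
by clear ke k0; lra.
Qed.

End Metrizable.

Theorem proposition6p8 (R : realType) (X Y : topologicalType)
    (sepX : separable_space X) (metX : metrizable R X)
    (nlcX : nowhere_locally_compact X)
    (sepY : separable_space Y) (metY : metrizable R Y)
    (nlcY : nowhere_locally_compact Y)
    (homXY : homeomorphic (set_type (remote_points R X))
                          (set_type (remote_points R Y))) :
  (choquet_space X <-> choquet_space Y) /\
  (meager_space X <-> meager_space Y).
Proof.
have [dX [_ dX0 dXC dX3 nbhsX]] := metX.
have [dY [_ dY0 dYC dY3 nbhsY]] := metY.
have [BX baseX] := metrizable_regular_base dX0 dXC dX3 nbhsX sepX.
have [BY baseY] := metrizable_regular_base dY0 dYC dY3 nbhsY sepY.
have cX := stone_cech_normal_compactification R
  (metrizable_normal dX0 dXC dX3 nbhsX).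
have cY := stone_cech_normal_compactification R
  (metrizable_normal dY0 dYC dY3 nbhsY).
have [f [g [cf cg fK gK]]] := homXY.
split; split.
- exact: (choquet_transfer baseX baseY cX cY nlcX nlcY cf cg fK gK).
- exact: (choquet_transfer baseY baseX cY cX nlcY nlcX cg cf gK fK).
- exact: (meager_transfer baseX baseY cX cY nlcX nlcY cf cg fK gK).
- exact: (meager_transfer baseY baseX cY cX nlcY nlcX cg cf gK fK).
Qed.
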